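(* Let $r \ge 2$ be an integer radix, let $\chi \subseteq \mathbb{R}$ be an interval, and let $f : \chi \to \mathbb{R}$ be twice differentiable with $f'(x) \neq 0$ for all $x\in\chi$ and with a root $x^{*} \in \chi$, $f(x^* )=0$. Let $T(x) := x - \frac{f(x)}{f'(x)}$, so that $T'(x) = \frac{f(x) f''(x)}{(f'(x))^2}$, and suppose there is a constant $L < 1$ with $|T'(x)| \le L$ for all $x \in \chi$. Let $(x^{(k)})_{k\in\mathbb{N}}$ be a sequence generated by Newton's method $x^{(k+1)} = T(x^{(k)})$ with $x^{(k)} \in \chi$ for all $k$. Then, given a number of digits $D \ge 1$, there exist an index $\hat{k} \ge 0$ and a representation of the iterate sequence (a choice of a symmetric maximally redundant radix-$r$ representation of each iterate) such that $$x^{(k)}_{i} = x^{(\hat{k})}_{i} \qquad \text{for all } i \in \{1,\dots,D\} \text{ and all } k > \hat{k}.$$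
   Context: Symmetric maximally redundant representation of radix $r$: the signed-digit representation with digit set $\{-(r-1),\dots,-1,0,1,\dots,r-1\}$. A real number $v$ is represented by a (finite or infinite) digit string $(v_i)_{i \ge -p}$, for some integer $p\ge 0$, with $v = \sum_{i \ge -p} v_i r^{-i}$; thus the digit with index $i$ has weight $r^{-i}$. Representations are not unique. Digits are indexed so that appending further digits after the digit with index $D$ changes the value by an amount in the interval $(-r^{-D}, r^{-D})$ (for finitely many appended digits). $x^{(k)}_i$ denotes the $i$-th digit of the chosen representation of $x^{(k)}$. The $D$ most-significant digits are those with indices $1,\dots,D$; any digits to the left of the radix point (indices $\le 0$) count as leading digits and are understood to be unchanged as well. *)

(* Defs.v *)
From HB Require Import structures.
From mathcomp Require Import all_boot all_order all_algebra.
From mathcomp Require Import all_classical all_reals all_analysis.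
Import Order.TTheory GRing.Theory Num.Theory.
Import numFieldNormedType.Exports.

Set Implicit Arguments.
Unset Strict Implicit.
Unset Printing Implicit Defensive.

Local Open Scope classical_set_scope.
Local Open Scope ring_scope.

(* The derivative of a function on A only looks at points of A: it is
   one-sided at an endpoint of an interval, two-sided in the interior.  The
   library's [derivable] and [derive1] are two-sided everywhere, and would
   depend on the values of f outside A at the endpoints.  As for [derive1],
   [deriv_on A f x] is meaningful only when [derivable_on A f x] holds. *)
Definition diff_quot (R : realType) (f : R -> R) (x : R) : R -> R :=
  fun y => (f y - f x) / (y - x).

Definition derivable_on (R : realType) (A : set R) (f : R -> R) (x : R) : Prop :=
  cvg (diff_quot f x @ within A x^').

Definition deriv_on (R : realType) (A : set R) (f : R -> R) (x : R) : R :=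
  lim (diff_quot f x @ within A x^').

Definition twice_derivable_on (R : realType) (A : set R) (f : R -> R) : Prop :=
  (forall x, A x -> derivable_on A f x) /\
  (forall x, A x -> derivable_on A (deriv_on A f) x).

Definition newton_map (R : realType) (A : set R) (f : R -> R) : R -> R :=
  fun x => x - f x / deriv_on A f x.

(* A digit string (v_i)_{i >= -p} is a function on int that vanishes below -p;
   a finite string is one that is also eventually 0.  The n-th term of the
   series, n = 0, 1, ..., is that of the digit of index i = n - p, whose weight
   is r^(-i). *)
Definition signed_digit_repr (R : realType) (r : nat) (v : int -> int) (x : R)
    : Prop :=
  (forall i : int, - (r%:Z - 1) <= v i <= r%:Z - 1) /\
  exists p : nat,
    (forall i : int, i < - p%:Z -> v i = 0) /\
    series (fun n : nat => (v (n%:Z - p%:Z))%:~R * r%:R ^ (- (n%:Z - p%:Z)))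
      @ \oo --> x.

(* Main.v *)
Require Import Defs.
From HB Require Import structures.
From mathcomp Require Import all_boot all_order all_algebra.
From mathcomp Require Import all_classical all_reals all_analysis.
From mathcomp Require Import ring lra zify.
Import Order.TTheory GRing.Theory Num.Theory.
Import numFieldNormedType.Exports.
Set Implicit Arguments.
Unset Strict Implicit.
Unset Printing Implicit Defensive.
Local Open Scope classical_set_scope.
Local Open Scope ring_scope.

(** The bound on the derivative of the Newton map T and the mean value theorem
    make T a contraction of chi that fixes the root, so the iterates converge
    to it ([lipschitz_on_interval], [contraction_cvg]).

    Convergence alone does not fix the leading digits in the usual
    representation: iterates on either side of a multiple of r^(-D) have
    different first D digits.  The redundancy removes this obstruction.  Let
    M be the floor of r^D times the root.  All but finitely many iterates x
    satisfy |x r^D - M| < 1, because the root does and the inequality is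
    strict.  The remainder x - M r^(-D) then has absolute value less than
    r^(-D), so its expansion, with digits of its own sign, has nothing at
    indices up to D, while the expansion of M r^(-D) has nothing beyond D.
    Superposing the two digit strings is therefore a signed-digit
    representation of x whose digits up to D depend only on M
    ([signed_digit_repr_prefix]).  The finitely many earlier iterates are
    represented in the same way, each with its own floor. *)

(** * Signed-digit expansions by truncation *)

(** Rounding towards zero, unlike the floor, sends all of (-1, 1) to 0; with it
    a negative number too has finitely many nonzero digits of negative index. *)
Definition int_part (R : archiRealDomainType) (y : R) : int :=
  if 0 <= y then Num.floor y else Num.ceil y.

Lemma int_partN (R : archiRealDomainType) (y : R) :
  int_part (- y) = - int_part y.
Proof.
rewrite /int_part oppr_ge0 !ceilNfloor opprK.
by have [y0|y0|->] := ltgtP y 0; rewrite ?opprK ?oppr0 ?floor0 ?oppr0.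
Qed.

Lemma int_part_intr (R : archiRealDomainType) (m : int) :
  int_part (m%:~R : R) = m.
Proof.
by rewrite /int_part ceilNfloor -mulrNz !intrKfloor opprK; case: ifP.
Qed.

Lemma int_part_eq0 (R : archiRealDomainType) (y : R) :
  `|y| < 1 -> int_part y = 0.
Proof.
rewrite ltr_norml => /andP[y1 y2]; rewrite /int_part; case: ifP => y0.
  by apply: floor_def; rewrite y0 add0r y2.
rewrite ceilNfloor (@floor_def _ _ 0) ?oppr0 // add0r.
by rewrite ltrNl y1 andbT oppr_ge0 ltW // ltNge y0.
Qed.

Lemma int_part_dist (R : archiRealDomainType) (y : R) :
  `|y - (int_part y)%:~R| <= 1.
Proof.
wlog y0 : y / 0 <= y.
  move=> h; case: (leP 0 y) => [/h //|y0].
  have : 0 <= - y by rewrite oppr_ge0 ltW.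
  by move=> /h; rewrite int_partN mulrNz -opprD normrN.
have /andP[h1] := floor_itv y; rewrite intrD /= => h2.
rewrite /int_part y0 ger0_norm ?subr_ge0 //; lra.
Qed.

(** For y >= 0 this is the remainder of the Euclidean division of the integer
    part of y by r, and y < 0 follows by oddness.  The range of digits is
    exactly the symmetric maximally redundant one. *)
Lemma int_part_digit_bound (R : archiRealFieldType) (r : nat) (y : R) :
  (0 < r)%N ->
  `|int_part y - r%:Z * int_part (y / r%:R)| <= r%:Z - 1.
Proof.
move=> r0; have r0R : (0 : R) < r%:R by rewrite ltr0n.
wlog y0 : y / 0 <= y.
  move=> h; case: (leP 0 y) => [/h //|y0].
  have : 0 <= - y by rewrite oppr_ge0 ltW.
  by move=> /h; rewrite mulNr !int_partN mulrN -opprD normrN.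
have yr0 : 0 <= y / r%:R by rewrite divr_ge0 // ltW.
rewrite /int_part y0 yr0.
have /andP[h1 h2] := floor_itv y; have /andP[] := floor_itv (y / r%:R).
set a := Num.floor _ in h1 h2 *; set b := Num.floor _.
rewrite ler_pdivlMr // ltr_pdivrMr // => h3 h4.
have le_b : r%:Z * b <= a.
  by rewrite -ltzD1 -(ltr_int R) intrM mulrC; exact: le_lt_trans h3 h2.
have lt_a : a < r%:Z * (b + 1).
  by rewrite -(ltr_int R) [X in _ < X]intrM mulrC; exact: le_lt_trans h1 h4.
by rewrite ger0_norm ?subr_ge0 // lerBrDr -ltzD1; move: lt_a; lia.
Qed.

(** For y >= 0 this is the usual base-r digit of weight r^(-i); for y < 0 it is
    the opposite of that of - y.  The difference form makes the series of
    digits telescope. *)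
Definition trunc_digit (R : archiRealFieldType) (r : nat) (y : R) (i : int) :
    int :=
  int_part (y * r%:R ^ i) - r%:Z * int_part (y * r%:R ^ (i - 1)).

Lemma trunc_digit_bound (R : archiRealFieldType) (r : nat) (y : R) (i : int) :
  (0 < r)%N -> `|trunc_digit r y i| <= r%:Z - 1.
Proof.
move=> r0; rewrite /trunc_digit expfzDr ?pnatr_eq0 -?lt0n //.
by rewrite exprN1 mulrA int_part_digit_bound.
Qed.

Lemma trunc_digit_lead0 (R : archiRealFieldType) (r : nat) (y : R)
    (p i : int) : (0 < r)%N -> `|y * r%:R ^ p| < 1 -> i <= p ->
  trunc_digit r y i = 0.
Proof.
move=> r0 yp.
have small j : j <= p -> int_part (y * r%:R ^ j) = 0.
  move=> jp; apply: int_part_eq0; apply: le_lt_trans yp.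
  rewrite !normrM ler_wpM2l // !ger0_norm ?exprz_ge0 ?ler0n //.
  by rewrite ler_weXz2l // ler1n.
move=> ip; rewrite /trunc_digit !small ?mulr0 ?subrr //.
by apply: le_trans ip; rewrite gerBl.
Qed.

(** For i > D, both numbers truncated in the digit of index i are integers,
    and the first is r times the second. *)
Lemma trunc_digit_tail0 (R : archiRealFieldType) (r : nat) (m D i : int) :
  (0 < r)%N -> D < i -> trunc_digit r (m%:~R * r%:R ^ (- D) : R) i = 0.
Proof.
move=> r0 Di; have r0R : r%:R != 0 :> R by rewrite pnatr_eq0 -lt0n.
have [n ->] : exists n : nat, i = n%:Z + 1 + D.
  by exists (absz (i - 1 - D)%R); lia.
rewrite /trunc_digit -!mulrA -!expfzDr //.
rewrite (_ : - D + (n%:Z + 1 + D) = n.+1%:Z); last by lia.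
rewrite (_ : - D + (n%:Z + 1 + D - 1) = n%:Z); last by lia.
have E k : m%:~R * (r%:R : R) ^ k%:Z = (m * r%:Z ^+ k)%:~R.
  by rewrite intrM rmorphXn.
by rewrite !E !int_part_intr exprS; ring.
Qed.

(** The sum telescopes; the hypothesis ensures that all digits of index
    below - p are 0. *)
Lemma trunc_digit_series (R : archiRealFieldType) (r p : nat) (y : R)
    (n : nat) :
  (0 < r)%N -> `|y * r%:R ^ (- p%:Z - 1)| < 1 ->
  series (fun n : nat =>
    (trunc_digit r y (n%:Z - p%:Z))%:~R * r%:R ^ (- (n%:Z - p%:Z)) : R) n
  = (int_part (y * r%:R ^ (n%:Z - p%:Z - 1)))%:~R * r%:R ^ (1 + p%:Z - n%:Z).
Proof.
move=> r0 yp; have r0R : r%:R != 0 :> R by rewrite pnatr_eq0 -lt0n.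
rewrite /series /=; elim: n => [|n IHn].
  by rewrite big_geq // sub0r int_part_eq0 // mul0r.
rewrite big_nat_recr //= IHn /trunc_digit intrD mulrNz intrM.
rewrite (_ : n.+1%:Z - p%:Z - 1 = n%:Z - p%:Z); last by lia.
rewrite (_ : 1 + p%:Z - n%:Z = - (n%:Z - p%:Z) + 1); last by lia.
rewrite (_ : 1 + p%:Z - n.+1%:Z = - (n%:Z - p%:Z)); last by lia.
by rewrite [X in _ * X + _]expfzDr // expr1z; ring.
Qed.

Lemma trunc_digit_cvg (R : realType) (r p : nat) (y : R) :
  (1 < r)%N -> `|y * r%:R ^ (- p%:Z - 1)| < 1 ->
  series (fun n : nat =>
    (trunc_digit r y (n%:Z - p%:Z))%:~R * r%:R ^ (- (n%:Z - p%:Z)) : R)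
  @ \oo --> y.
Proof.
move=> r1 yp; have r0 := ltnW r1.
have r0R : (0 : R) < r%:R by rewrite ltr0n.
have g0 : geometric ((r%:R : R) ^ (1 + p%:Z)) (r%:R^-1) @ \oo --> (0 : R).
  apply: cvg_geometric.
  by rewrite ger0_norm ?invr_ge0 ?ltW // invf_lt1 // ltr1n.
apply/cvgrPdist_le => e e0.
have /cvgrPdist_le /(_ e e0) := g0; apply: filterS => n /=.
rewrite sub0r normrN ger0_norm ?mulr_ge0 ?exprz_ge0 ?exprn_ge0 ?invr_ge0 //.
apply: le_trans; rewrite trunc_digit_series //.
rewrite exprVn exprnN -expfzDr ?gt_eqF //.
set q := n%:Z - p%:Z - 1.
rewrite (_ : 1 + p%:Z - n%:Z = - q); last by rewrite /q; lia.
have qK : r%:R ^ q * r%:R ^ (- q) = 1 :> R.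
  by rewrite -expfzDr ?gt_eqF // subrr expr0z.
have yE : y = y * r%:R ^ q * r%:R ^ (- q) by rewrite -mulrA qK mulr1.
rewrite {1}yE -mulrBl normrM.
rewrite [X in _ * X]ger0_norm ?exprz_ge0 //.
by rewrite ler_piMl ?exprz_ge0 // int_part_dist.
Qed.

(** The digits up to D are those of m r^(-D), and the further ones are those of
    the remainder v = x - m r^(-D).  The signs of m and v may differ, which is
    where the signed digits are needed. *)
Lemma signed_digit_repr_prefix (R : realType) (r : nat) (m D : int) (x : R) :
  (1 < r)%N -> `|x * r%:R ^ D - m%:~R| < 1 ->
  exists2 d : int -> int, signed_digit_repr r d x &
    forall i, i <= D -> d i = trunc_digit r (m%:~R * r%:R ^ (- D) : R) i.
Proof.
move=> r1 xm; have r0 := ltnW r1.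
have r0R : (0 : R) < r%:R by rewrite ltr0n.
set u : R := m%:~R * r%:R ^ (- D); pose v := x - u.
have vD : `|v * r%:R ^ D| < 1.
  by rewrite /v /u mulrBl -mulrA -expfzDr ?gt_eqF // addNr expr0z mulr1.
have v0 i : i <= D -> trunc_digit r v i = 0 by exact: trunc_digit_lead0.
(* At each index one of the two summands is 0, so no carry occurs. *)
exists (fun i => trunc_digit r u i + trunc_digit r v i); last first.
  by move=> i iD; rewrite v0 ?addr0.
split=> [i|].
  rewrite -ler_norml; have [iD|Di] := leP i D.
    by rewrite v0 // addr0 trunc_digit_bound.
  by rewrite trunc_digit_tail0 // add0r trunc_digit_bound.
(* The series of u and v must start at the same index to be added: this p
   works for both because |u| + |v| < p + 1 < r ^ (p + 1). *)
pose p := Num.truncn (`|u| + `|v|).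
have small w : `|w| <= `|u| + `|v| -> `|w * r%:R ^ (- p%:Z - 1)| < 1.
  move=> w_le; rewrite (_ : - p%:Z - 1 = - p.+1%:Z); last by lia.
  rewrite -exprnN normrM [X in _ * X]ger0_norm ?invr_ge0 ?exprn_ge0 //.
  rewrite ltr_pdivrMr ?exprn_gt0 // mul1r (le_lt_trans w_le) //.
  apply: lt_le_trans (truncnS_gt _) _.
  by rewrite -natrX ler_nat ltnW // ltn_expl.
have up : `|u * r%:R ^ (- p%:Z - 1)| < 1 by apply: small; rewrite lerDl.
have vp : `|v * r%:R ^ (- p%:Z - 1)| < 1 by apply: small; rewrite lerDr.
exists p; split=> [i ip|].
  by rewrite !(trunc_digit_lead0 (p := - p%:Z - 1)) //; lia.
have uv : u + v = x by rewrite /v addrC subrK.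
rewrite -[X in _ --> X]uv.
apply: cvg_trans (cvgD (trunc_digit_cvg r1 up) (trunc_digit_cvg r1 vp)).
apply: near_eq_cvg; apply: nearW => n.
rewrite fctE /series /= -big_split /=.
by apply: eq_bigr => k _; rewrite intrD mulrDl.
Qed.

(** * Derivatives relative to a set *)

Lemma derivable_on_cvg (R : realType) (A : set R) (f : R -> R) (x : R) :
  derivable_on A f x -> f y @[y --> within A x^'] --> f x.
Proof.
move=> df.
have id_x : (y : R) @[y --> within A x^'] --> x.
  by apply: cvg_within_filter; apply: cvg_within_filter; exact: cvg_id.
have : diff_quot f x y * (y - x) + f x @[y --> within A x^'] --> f x.
  rewrite -[X in _ --> X]add0r -(mulr0 (deriv_on A f x)) -(subrr x).
  by apply: cvgD (cvg_cst _); apply: cvgM => //; apply: cvgB id_x (cvg_cst _).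
apply: cvg_trans; apply: near_eq_cvg.
apply: cvg_within; apply: filterS (nbhs_dnbhs_neq x) => y yx /=.
by rewrite /diff_quot mulfVK ?subrK // subr_eq0.
Qed.

(** The difference quotient of f / f' is rearranged, for y <> x, into
    (f y - f x) / (y - x) / f' y
      - f x / f' x * ((f' y - f' x) / (y - x) / f' y),
    each factor of which converges as y tends to x. *)
Lemma newton_map_derivable_on (R : realType) (A : set R) (f : R -> R) :
  twice_derivable_on A f -> (forall x, A x -> deriv_on A f x != 0) ->
  forall x, A x -> derivable_on A (newton_map A f) x.
Proof.
move=> [df ddf] f'_neq0 x Ax; set g := deriv_on A f.
have gx0 : g x != 0 := f'_neq0 x Ax.
have inv_g : (g y)^-1 @[y --> within A x^'] --> (g x)^-1.
  by apply: cvgV => //; exact: derivable_on_cvg (ddf x Ax).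
apply: cvgP.
have : 1 - (diff_quot f x y * (g y)^-1
    - f x / g x * (diff_quot g x y * (g y)^-1)) @[y --> within A x^']
  --> 1 - (deriv_on A f x * (g x)^-1
    - f x / g x * (deriv_on A g x * (g x)^-1)).
  apply: cvgB; first exact: cvg_cst.
  apply: cvgB; first exact: cvgM (df x Ax) inv_g.
  apply: cvgM; first exact: cvg_cst.
  exact: cvgM (ddf x Ax) inv_g.
apply: cvg_trans; apply: near_eq_cvg.
rewrite near_withinE; apply: filterS (nbhs_dnbhs_neq x) => y yx Ay.
have gy0 : g y != 0 := f'_neq0 y Ay.
rewrite /diff_quot /newton_map -/g.
have yx0 : y - x != 0 by rewrite subr_eq0.
by field; rewrite ?gx0 ?gy0 ?yx0.
Qed.

Lemma derivable_on_is_derive (R : realType) (A : set R) (f : R -> R) (x : R) :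
  nbhs x A -> derivable_on A f x -> is_derive x 1 f (deriv_on A f x).
Proof.
move=> Ax df.
suff h : h^-1 *: (f (h *: 1 + x) - f x) @[h --> 0^'] --> deriv_on A f x.
  by split; [exact: cvgP h | exact: cvg_lim h].
apply/cvgrPdist_lt => e e0.
have /cvgrPdist_lt /(_ e e0) := df.
rewrite !near_withinE => H.
have {H} : \forall y \near x, y != x -> `|deriv_on A f x - diff_quot f x y| < e.
  by apply: filterS2 Ax H => y Ay Hy yx; exact: Hy.
rewrite (near_shift 0) subr0; apply: filterS => h /= H h0.
have := H; rewrite /diff_quot addrK -subr_eq0 addrK => /(_ h0).
rewrite mulrC; congr (`|_ - _ * (f (_ + _) - _)| < _).
by rewrite /GRing.scale /= mulr1.
Qed.

(** * Contractions of an interval *)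

Lemma interval_nbhs (R : realType) (A : set R) (a b x : R) :
  is_interval A -> A a -> A b -> a < x < b -> nbhs x A.
Proof.
move=> itvA Aa Ab /andP[ax xb].
have : x \in `]a, b[ by rewrite in_itv /= ax xb.
move=> /near_in_itvoo; apply: filterS => y.
by rewrite in_itv /= => /andP[ay yb]; apply: (itvA a b) => //; rewrite !ltW.
Qed.

(** The mean value theorem on [y, x] needs two-sided derivatives only in the
    open segment, where A is a neighbourhood of every point and the relative
    derivative is the ordinary one; at the endpoints relative derivability still
    gives the one-sided continuity. *)
Lemma lipschitz_on_interval (R : realType) (A : set R) (g : R -> R) (L : R) :
    is_interval A -> (forall x, A x -> derivable_on A g x) ->
    (forall x, A x -> `|deriv_on A g x| <= L) ->
  forall x y, A x -> A y -> `|g x - g y| <= L * `|x - y|.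
Proof.
move=> itvA dg gL x y; wlog xy : x y / y < x.
  move=> H Ax Ay; have [xy|yx|->] := ltgtP x y.
  - by rewrite distrC (distrC x) H.
  - by rewrite H.
  - by rewrite !subrr normr0 mulr0.
move=> Ax Ay.
have sub z : y <= z <= x -> A z by exact: itvA.
have [||c] := @MVT_segment R g (deriv_on A g) y x (ltW xy).
- move=> z; rewrite in_itv /= => zyx; have Az := interval_nbhs itvA Ay Ax zyx.
  by apply: derivable_on_is_derive => //; apply: dg; exact: nbhs_singleton.
- apply/subspace_continuousP => z /=; rewrite in_itv /= => /sub Az.
  have := derivable_on_cvg (dg z Az) => gz.
  apply/cvgrPdist_lt => e e0; have /cvgrPdist_lt /(_ e e0) := gz.
  rewrite !near_withinE; apply: filterS => t H; rewrite /= in_itv /= => /sub At.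
  by have [->|tz] := eqVneq t z; [rewrite subrr normr0 | exact: H].
rewrite in_itv /= => /sub Ac ->.
by rewrite normrM ler_wpM2r ?gL.
Qed.

Lemma contraction_cvg (R : realType) (A : set R) (T : R -> R) (L xs : R)
    (x : nat -> R) :
    0 <= L < 1 -> (forall u v, A u -> A v -> `|T u - T v| <= L * `|u - v|) ->
    A xs -> T xs = xs -> (forall k, A (x k)) -> (forall k, x k.+1 = T (x k)) ->
  x @ \oo --> xs.
Proof.
move=> /andP[L0 L1] lip Axs Txs Ax xT.
have bound k : `|xs - x k| <= geometric `|xs - x 0%N| L k.
  elim: k => [|k IHk]; first by rewrite /= expr0 mulr1.
  rewrite xT -[X in `|X - _|]Txs (le_trans (lip _ _ Axs (Ax k))) //.
  by rewrite /= exprS mulrCA ler_wpM2l.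
apply/cvgrPdist_le => e e0.
have : geometric `|xs - x 0%N| L @ \oo --> (0 : R).
  by apply: cvg_geometric; rewrite ger0_norm.
move=> /cvgrPdist_le /(_ e e0); apply: filterS => k.
rewrite sub0r normrN; apply: le_trans; apply: le_trans (bound k) _.
exact: ler_norm.
Qed.

(** * Stable leading digits of the Newton iterates *)

Theorem mainTheorem5 (R : realType) (r : nat) (hr : (2 <= r)%N)
    (chi : set R) (hchi : is_interval chi)
    (f : R -> R) (hf : twice_derivable_on chi f)
    (hf' : forall x : R, chi x -> deriv_on chi f x != 0)
    (xstar : R) (hxstar : chi xstar) (hroot : f xstar = 0)
    (L : R) (hL : L < 1)
    (hT : forall x : R, chi x -> `|deriv_on chi (newton_map chi f) x| <= L)
    (x : nat -> R) (hx : forall k : nat, chi (x k))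
    (hnewton : forall k : nat, x k.+1 = newton_map chi f (x k))
    (D : nat) (hD : (1 <= D)%N) :
  exists (khat : nat) (d : nat -> int -> int),
    (forall k : nat, signed_digit_repr r (d k) (x k)) /\
    (forall k : nat, (khat < k)%N ->
       forall i : int, i <= D%:Z -> d k i = d khat i).
Proof.
have x_cvg : x @ \oo --> xstar.
  apply: (contraction_cvg (L := L) _ _ hxstar _ hx hnewton).
  - by rewrite hL andbT (le_trans (normr_ge0 _) (hT _ hxstar)).
  - exact: lipschitz_on_interval (newton_map_derivable_on hf hf') hT.
  - by rewrite /newton_map hroot mul0r subr0.
have floor_dist (y : R) : `|y - (Num.floor y)%:~R| < 1.
  have /andP[fy] := floor_itv y; rewrite intrD /= => yf.
  by rewrite ger0_norm ?subr_ge0 // ltrBlDl.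
pose M := Num.floor (xstar * r%:R ^ D%:Z).
have : `|x k * r%:R ^ D%:Z - M%:~R| @[k --> \oo]
    --> `|xstar * r%:R ^ D%:Z - M%:~R|.
  by apply: cvg_norm; apply: cvgB; [apply: cvgMl | exact: cvg_cst].
move=> /cvgr_lt /(_ _ (floor_dist _)) [K _ close].
pose m k := if (K <= k)%N then M else Num.floor (x k * r%:R ^ D%:Z).
have /choice[d dP] k : exists d : int -> int, signed_digit_repr r d (x k) /\
    forall i, i <= D%:Z ->
      d i = trunc_digit r ((m k)%:~R * r%:R ^ (- D%:Z) : R) i.
  have [|e] := @signed_digit_repr_prefix R r (m k) D%:Z (x k) hr.
    by rewrite /m; case: ifP => [/close|_].
  by exists e.
exists K, d; split=> [k|k Kk i iD]; first by case: (dP k).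
by rewrite (dP k).2 // (dP K).2 // /m leqnn (ltnW Kk).
Qed.
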